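(* Let $m\ge1$ and let $M(t)$ denote the greedy matching after $t$ steps of the uniform attachment process. Let $r_m$ denote the unique positive root of $2(1-z^m)-z=0$ (one has $r_m=1-m^{-1}\log2+O(m^{-2})$). Then for any $\alpha<1/3$, almost surely $$\lim_{t\to\infty}t^{\alpha}\left|\frac{2|M(t)|}{t}-r_m\right|=0.$$
   Context: Uniform attachment process (integer $m\ge1$): start with the single vertex $1$; for each $t\ge1$, vertex $t+1$ selects $m$ vertices from $[t]$ independently and uniformly at random (repetitions allowed) and is joined by an edge to each selected vertex. Greedy matching algorithm: $M(1)=\emptyset$; given the matching $M(t)$ on $[t]$, if vertex $t+1$ selects some vertex $u\in[t]$ not covered by $M(t)$ (if several, one of them is chosen), set $M(t+1)=M(t)\cup\{\{u,t+1\}\}$; otherwise $M(t+1)=M(t)$. $|M(t)|$ is the number of edges of $M(t)$. *)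

(* Defs.v *)
From HB Require Import structures.
From mathcomp Require Export all_boot all_order all_algebra finmap.
From mathcomp Require Export all_classical all_reals all_analysis.
Export Order.TTheory GRing.Theory Num.Theory numFieldNormedType.Exports.

#[global] Set Implicit Arguments.
#[global] Unset Strict Implicit.
#[global] Unset Printing Implicit Defensive.

#[global] Open Scope classical_set_scope.
#[global] Open Scope ring_scope.

Definition covered (M : {fset {fset nat}}) (u : nat) : Prop :=
  exists2 e : {fset nat}, e \in M & u \in e.

Section process.
Context (R : realType) (d : measure_display) (T : measurableType d).
Variables (P : probability T R) (m : nat).

(* [sel t i w] is the [i]-th of the [m] vertices selected by vertex [t.+1];
   vertices are numbered from 1, so it is meaningful for [1 <= t] only, and so
   is the matching [M t w] on the vertex set {1, ..., t}. *)
Variables (sel : nat -> 'I_m -> T -> nat) (M : nat -> T -> {fset {fset nat}}).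

(* All selections made by the vertices 2, ..., t, and M(1), ..., M(t). *)
Definition history (t : nat) (w : T) : seq (seq nat) * seq {fset {fset nat}} :=
  ([seq [seq sel s i w | i <- enum 'I_m] | s <- iota 1 t.-1],
   [seq M s w | s <- iota 1 t]).

(* The process is joint with the matchings because the rule choosing between
   several uncovered selected vertices is arbitrary (it may use additional
   randomness): what matters is that the selections of vertex t+1 are
   independent of everything up to time t, including M(1), ..., M(t).  As all
   variables are discrete, mutual independence of the history and the m
   selections is the product rule on atoms; by induction on t it contains the
   mutual independence of the whole family of selections. *)
Definition uniform_attachment : Prop :=
  [/\ forall t h, (1 <= t)%N -> measurable [set w | history t w = h],
      forall t i w, (1 <= t)%N -> (1 <= sel t i w <= t)%N,
      forall t i k, (1 <= k <= t)%N ->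
        P [set w | sel t i w = k] = (t%:R^-1)%:E &
      forall t h (v : 'I_m -> nat), (1 <= t)%N ->
        (P [set w | history t w = h /\ forall i, sel t i w = v i] =
         P [set w | history t w = h] *
           \prod_(i < m) P [set w | sel t i w = v i])%E].

Definition greedy_matching : Prop :=
  forall w, M 1 w = fset0 /\
    forall t, (1 <= t)%N ->
      (exists i, ~ covered (M t w) (sel t i w) /\
         M t.+1 w = ([fset [fset sel t i w; t.+1]] `|` M t w)%fset) \/
      ((forall i, covered (M t w) (sel t i w)) /\ M t.+1 w = M t w).

End process.

Definition pos_root (R : realType) (m : nat) (z : R) : Prop :=
  0 < z /\ 2 * (1 - z ^+ m) - z = 0.

(* Main.v *)
Require Import Defs.
From mathcomp Require Import lra ring zify.

(* The covered vertices number X_t = 2|M(t)|, and given the past X increases by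
   2 with probability 1 - (X_t/t)^m.  So Z_t = X_t/t moves by
   (g(Z_t) + noise)/(t+1) with g(z) = 2(1 - z^m) - z, and
   (z - r) g(z) <= -(z - r)^2 because g(r) = 0 and z^m is nondecreasing.  Hence
   (t+1) t E(Z_{t+1} - r)^2 <= t (t-1) E(Z_t - r)^2 + 4, which gives
   E(Z_t - r)^2 <= 4/t.  Along t = k^3, Chebyshev and Borel-Cantelli yield the
   rate t^-b for every b < 1/3, and between consecutive cubes Z_t varies by
   O(1/k) = O(t^(-1/3)).

   For the root, s = 1 - r and L = -ln r satisfy m L = ln 2 - ln(1 + s) and
   L - L^2 <= s <= L <= 1/m, so s = ln 2 / m + O(1/m^2). *)

(** * The root of 2(1 - z^m) = z and its asymptotics *)

Section root.
Variable R : realType.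
Implicit Types (m n : nat) (x y z r : R).

Lemma pos_root_lt1 m r : (0 < m)%N -> pos_root m r -> r < 1.
Proof.
move=> m0 [r0 er]; rewrite ltNge; apply/negP => r1.
by have : 1 <= r ^+ m by [exact: exprn_ege1]; lra.
Qed.

(** Monotonicity of z^m in the form that serves both uniqueness of the root and the drift inequality
    of [card_second_moment]. *)
Lemma mulr_subX_ge0 m x y : 0 <= x -> 0 <= y -> 0 <= (x - y) * (x ^+ m - y ^+ m).
Proof.
move=> x0 y0; have [xy|/ltW yx] := leP x y.
  by rewrite mulr_le0// subr_le0 ?lerXn2r.
by rewrite mulr_ge0// subr_ge0 ?lerXn2r.
Qed.

Lemma pos_root_uniq m x y : pos_root m x -> pos_root m y -> x = y.
Proof.
move=> [x0 ex] [y0 ey].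
have := mulr_subX_ge0 m (ltW x0) (ltW y0).
(* The root equations turn the nonnegative product into -(x - y)^2 / 2. *)
have -> : x ^+ m - y ^+ m = (y - x) / 2 by lra.
move=> xy; apply/eqP; rewrite -subr_eq0 -sqrf_eq0 -(@eqr_pMn2r _ 1)//.
by rewrite eq_le mul0rn sqr_ge0 andbT; lra.
Qed.

Lemma pos_root_exists m : (0 < m)%N -> exists r, pos_root m r.
Proof.
(* The sign is reversed so that p(0) = -2 and p(1) = 1 suit the intermediate value theorem. *)
move=> m0; pose p : {poly R} := 'X^m *+ 2 + 'X - 2%:P.
have pE z : p.[z] = z ^+ m *+ 2 + z - 2 by rewrite /p !hornerE.
have [|r /andP[r0 r1] /rootP pr] := @poly_ivt _ p 0 1 ler01.
  by rewrite !pE expr0n expr1n gtn_eqF//=; apply/andP; split; lra.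
rewrite pE in pr; exists r; split; last by lra.
rewrite lt_neqAle r0 andbT eq_sym; apply/eqP => r0'.
by move: pr; rewrite r0' expr0n gtn_eqF//=; lra.
Qed.

Lemma pos_root_asymptotics m r : (0 < m)%N -> pos_root m r ->
  `|r - (1 - m%:R^-1 * ln 2)| <= 2 * m%:R ^- 2.
Proof.
move=> m0 pr; have r1 := pos_root_lt1 m0 pr; case: pr => r0 er.
have mr0 : 0 < m%:R :> R by rewrite ltr0n.
pose L := - ln r; pose k := m%:R^-1 : R.
have k0 : 0 < k by rewrite invr_gt0.
(* Logarithm of r^m = (2 - r)/2, divided by m. *)
have mL : L = k * ln 2 - k * ln (2 - r).
  have : ln (r ^+ m) = ln (2^-1 * (2 - r)) by congr ln; lra.
  rewrite lnXn// lnM ?posrE; [|lra|lra].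
  rewrite lnV ?posrE// -[ln r *+ m]mulr_natl => e.
  rewrite -mulrBr /L /k; apply: (mulfI (lt0r_neq0 mr0)).
  by rewrite mulrA mulfV ?lt0r_neq0// mul1r mulrN e; lra.
have l2 : ln 2 <= 1 :> R by have := @le_ln1Dx R 1; rewrite -[1 + 1]/2; lra.
have ls0 : 0 <= ln (2 - r) by rewrite ln_ge0; lra.
have ls : ln (2 - r) <= 1 - r.
  by have := @le_ln1Dx R (1 - r); rewrite (_ : 1 + (1 - r) = 2 - r); lra.
have Lk : L <= k by nra.
have sL : 1 - r <= L.
  by have := @le_ln1Dx R (r - 1); rewrite (_ : 1 + (r - 1) = r) /L; lra.
(* Since exp L = 1/r, the bound exp L >= 1 + L gives r(1 + L) <= 1, that is L - s <= s L <= L^2 with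
   s = 1 - r. *)
have L0 : 0 <= L by lra.
have eL : r * (1 + L) <= 1.
  have := expR_ge1Dx L; rewrite /L expRN lnK ?posrE// => h.
  by rewrite mulrC -ler_pdivlMr// div1r.
have sL2 : L - L ^+ 2 <= 1 - r by nra.
have L2 : L ^+ 2 <= k ^+ 2 by rewrite lerXn2r ?nnegrE// ltW.
have kls : k * ln (2 - r) <= k ^+ 2 by nra.
have -> : m%:R ^- 2 = k ^+ 2 by rewrite exprVn.
(* The error equals (L - s) + k ln(2 - r); both terms lie in [0, k^2], whence the constant 2. *)
rewrite -/k ler_norml; apply/andP; split; nra.
Qed.

End root.

(** * Pathwise combinatorics of the greedy matching *)

Lemma covered_fsetU1 (N : {fset {fset nat}}) (u v j : nat) :
  covered ([fset [fset u; v]] `|` N)%fset j <-> j = u \/ j = v \/ covered N j.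
Proof.
split=> [[e]|].
  rewrite !inE => /predU1P[-> |eN je]; last by right; right; exists e.
  by rewrite !inE => /orP[/eqP-> |/eqP->]; [left|right; left].
case=> [-> |[-> |[e eN je]]].
- by exists [fset u; v]%fset; rewrite !inE eqxx.
- by exists [fset u; v]%fset; rewrite !inE eqxx ?orbT.
- by exists e => //; rewrite !inE eN orbT.
Qed.

Lemma count_predU1_notin (T : eqType) (a : pred T) (s : seq T) (u : T) :
  uniq s -> u \in s -> ~~ a u ->
  count (fun j => (j == u) || a j) s = (count a s).+1.
Proof.
move=> us su au; have := count_predUI (pred1 u) a s.
rewrite (count_uniq_mem _ us) su (@eq_count _ (predI (pred1 u) a) pred0).
  by rewrite count_pred0 addn0 add1n.
by move=> j /=; case: eqP => // ->; exact: negbTE.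
Qed.

(** Selections are later counted as functions into ['I_t], where [j] stands for the vertex
    [j.+1]. *)
Lemma card_ord_count (t : nat) (a : pred nat) :
  #|[pred j : 'I_t | a j.+1]| = count a (iota 1 t).
Proof.
rewrite cardE size_filter -(addn0 1%N) iotaDl count_map.
rewrite -val_enum_ord count_map enumT.
by apply: eq_count.
Qed.

Section greedy.
Context (d : measure_display) (T : measurableType d) (m : nat).
Variables (sel : nat -> 'I_m -> T -> nat) (M : nat -> T -> {fset {fset nat}}).
Hypothesis sel_range : forall t i w, (1 <= t)%N -> (1 <= sel t i w <= t)%N.
Hypothesis greedyM : greedy_matching sel M.

Lemma covered_range t w j : (1 <= t)%N -> covered (M t w) j -> (1 <= j <= t)%N.
Proof.
case: t => // t _; elim: t j => [|t IH] j.
  by rewrite (greedyM w).1 => -[e]; rewrite inE.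
have [[i [_ ->]]|[_ ->]] := (greedyM w).2 t.+1 isT; last first.
  by move=> /IH; lia.
move=> /covered_fsetU1[-> |[-> |/IH]]; [|lia|lia].
by have := @sel_range t.+1 i w isT; lia.
Qed.

Lemma card_matching_stay t w : (1 <= t)%N ->
  (forall i, covered (M t w) (sel t i w)) -> #|` M t.+1 w| = #|` M t w|.
Proof.
by move=> t0 D; have [[i [/(_ (D i))//]]|[_ ->]] := (greedyM w).2 t t0.
Qed.

Lemma card_matching_grow t w : (1 <= t)%N ->
  ~ (forall i, covered (M t w) (sel t i w)) -> #|` M t.+1 w| = (#|` M t w|).+1.
Proof.
move=> t0 D; have [[i [ci ->]]|[//]] := (greedyM w).2 t t0.
rewrite cardfsU1 (_ : _ \notin _)//; apply/negP => eM; apply: ci.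
by exists [fset sel t i w; t.+1]%fset => //; rewrite !inE eqxx.
Qed.

(** An added edge covers exactly two new vertices: the selected one, uncovered by the greedy rule,
    and the newcomer, uncovered because M(t) lives on [t]. *)
Lemma count_covered t w : (1 <= t)%N ->
  count (fun j => `[< covered (M t w) j >]) (iota 1 t) = (#|` M t w|).*2.
Proof.
case: t => // t _; elim: t => [|t IH].
  rewrite (greedyM w).1 cardfs0 /= asboolF// => -[e]; by rewrite inE.
have -> : iota 1 t.+2 = iota 1 t.+1 ++ [:: t.+2].
  by rewrite -[t.+2 in LHS]addn1 iotaD add1n.
rewrite count_cat [count _ [:: _]]/= addn0.
have [[i [ci eM]]|[D eM]] := (greedyM w).2 t.+1 isT; last first.
  rewrite eM IH asboolF ?addn0// => /covered_range; lia.
rewrite (card_matching_grow _ (contra_not (fun D => D i) ci))// doubleS -IH.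
rewrite asboolT; last by rewrite eM; apply/covered_fsetU1; right; left.
rewrite addn1; congr _.+1.
rewrite -(@count_predU1_notin _ _ _ (sel t.+1 i w)) ?iota_uniq//; last first.
- by apply/asboolPn.
- by rewrite mem_iota; have := @sel_range t.+1 i w isT; lia.
apply: eq_in_count => j; rewrite mem_iota => jt.
apply/asboolP/orP; rewrite eM; first (move=> /covered_fsetU1[-> |[jE|cj]]).
- by left.
- by lia.
- by right; apply/asboolP.
- by case=> [/eqP-> |/asboolP cj]; apply/covered_fsetU1; [left|right; right].
Qed.

Lemma card_matching_le t w : (1 <= t)%N -> ((#|` M t w|).*2 <= t)%N.
Proof.
move=> t0; rewrite -count_covered//.
by rewrite (leq_trans (count_size _ _))// size_iota.
Qed.

Lemma card_matching_mono s t w : (1 <= s)%N -> (s <= t)%N ->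
  (#|` M s w| <= #|` M t w| <= #|` M s w| + (t - s))%N.
Proof.
move=> s0 /subnKC <-; elim: (t - s)%N => [|k IH]; first by rewrite addn0; lia.
have [D|D] := pselect (forall i, covered (M (s + k) w) (sel (s + k) i w)).
  by rewrite addnS (card_matching_stay _ D)//; lia.
by rewrite addnS (card_matching_grow _ D)//; lia.
Qed.

Lemma history_matching t w w' : (1 <= t)%N ->
  history sel M t w = history sel M t w' -> M t w = M t w'.
Proof.
move=> t0 [_ /(congr1 (fun s => nth fset0 s t.-1))].
rewrite !(nth_map 0%N) ?size_iota ?prednK// nth_iota ?prednK// add1n.
by rewrite prednK.
Qed.

Lemma history_sel t w w' i : (1 <= t)%N ->
  history sel M t.+1 w = history sel M t.+1 w' -> sel t i w = sel t i w'.
Proof.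
move=> t0 [/(congr1 (fun s => nth [::] s t.-1)) + _].
rewrite !(nth_map 0%N) ?size_iota ?prednK// nth_iota ?prednK// add1n prednK//.
by move=> /eq_in_map /(_ i); rewrite mem_enum => /(_ isT).
Qed.

Lemma history_pred t w w' : (1 <= t)%N ->
  history sel M t.+1 w = history sel M t.+1 w' ->
  history sel M t w = history sel M t w'.
Proof.
move=> t0 /eqP; rewrite xpair_eqE => /andP[/eqP/eq_in_map e1 /eqP/eq_in_map e2].
congr pair.
  by apply/eq_in_map => s; rewrite mem_iota => hs; apply: e1; rewrite mem_iota; lia.
by apply/eq_in_map => s; rewrite mem_iota => hs; apply: e2; rewrite mem_iota; lia.
Qed.

End greedy.

(** * Measurability, and the conditional probability that a step adds no edge *)

Lemma measure_scale_fibers (R : realType) (d : measure_display)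
    (T : measurableType d) (mu : {measure set T -> \bar R}) (X : countType)
    (h : T -> X) (A B : set T) (c : R) :
  (forall x, measurable (A `&` [set w | h w = x])) ->
  (forall x, measurable (B `&` [set w | h w = x])) ->
  (forall x, mu (A `&` [set w | h w = x]) =
     c%:E * mu (B `&` [set w | h w = x]))%E ->
  (mu A = c%:E * mu B)%E.
Proof.
move=> mA mB AB.
(* Fibres of [h] enumerated by their codes; an [n] that codes no value contributes the empty set. *)
pose F (C : set T) n :=
  if @pickle_inv X n is Some x then C `&` [set w | h w = x] else set0.
have FE C : C = \bigcup_n F C n.
  apply/seteqP; split=> [w Cw|w [n _]]; rewrite /F.
    by exists (choice.pickle (h w)) => //; rewrite /F pickleK_inv.
  by case: pickle_inv => // x [].
have trivF C : trivIset setT (F C).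
  move=> i j _ _ [w []]; rewrite /F.
  case ei : (pickle_inv i) => [x|//] [_ /= hx].
  case ej : (pickle_inv j) => [y|//] [_ /= hy].
  have := @pickle_invK X i; have := @pickle_invK X j.
  by rewrite ei ej /= => <- <-; rewrite -hx -hy.
have mFA n : measurable (F A n) by rewrite /F; case: pickle_inv.
have mFB n : measurable (F B n) by rewrite /F; case: pickle_inv.
rewrite [in LHS](FE A) [in RHS](FE B) !measure_semi_bigcup//; last 2 first.
- exact: bigcup_measurable.
- exact: bigcup_measurable.
rewrite -nneseriesZl//; apply: eq_eseriesr => n _; rewrite /F.
by case: pickle_inv => [x|]; rewrite ?measure0 ?mule0.
Qed.

Section process.
Context (R : realType) (d : measure_display) (T : measurableType d).
Context (P : probability T R) (m : nat).
Variables (sel : nat -> 'I_m -> T -> nat) (M : nat -> T -> {fset {fset nat}}).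
Hypothesis uaP : uniform_attachment P sel M.
Hypothesis greedyM : greedy_matching sel M.

Let sel_range : forall t i w, (1 <= t)%N -> (1 <= sel t i w <= t)%N.
Proof. by case: uaP. Qed.

(** Histories form a countable type, so such a set is a countable union of measurable history
    atoms. *)
Lemma measurable_history t (A : set T) : (1 <= t)%N ->
  (forall w w', history sel M t w = history sel M t w' -> A w -> A w') ->
  measurable A.
Proof.
move=> t0 hA; pose F h := A `&` [set w | history sel M t w = h].
have -> : A = \bigcup_h F h.
  by apply/seteqP; split=> [w Aw|w [h _ []//]]; exists (history sel M t w).
apply: countable_bigcupT_measurable => [|h]; first exact: countableP.
have [[w Aw wh]|nA] := pselect (exists2 w, A w & history sel M t w = h).
  have -> : F h = [set w | history sel M t w = h].
    apply/seteqP; split=> [w' []//|w' hw']; split => //.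
    by apply: (hA w) => //; rewrite wh hw'.
  by case: uaP => + _ _ _; apply.
have -> : F h = set0 by apply/seteqP; split=> [w [Aw wh]|//]; apply: nA; exists w.
exact: measurable0.
Qed.

Definition all_covered t : set T :=
  [set w | forall i, covered (M t w) (sel t i w)].

Lemma measurable_card t x : (1 <= t)%N -> measurable [set w | #|` M t w| = x].
Proof.
by move=> t0; apply: (measurable_history t0) => w w' /history_matching /= ->.
Qed.

Lemma measurable_all_covered t : (1 <= t)%N -> measurable (all_covered t).
Proof.
(* The selections of vertex [t.+1] enter the history only at time [t.+1]. *)
move=> t0; apply: (@measurable_history t.+1) => // w w' hw D i.
rewrite -(history_sel i t0 hw) -(history_matching t0 (history_pred t0 hw)).
exact: D.
Qed.

Lemma prob_selection t h (v : {ffun 'I_m -> 'I_t}) : (1 <= t)%N ->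
  (P [set w | history sel M t w = h /\ forall i, sel t i w = (v i).+1] =
   (t%:R ^- m)%:E * P [set w | history sel M t w = h])%E.
Proof.
move=> t0; case: uaP => _ _ uP ->//.
rewrite muleC; congr (_ * _)%E.
under eq_bigr => i _ do rewrite uP ?ltn_ord//.
by rewrite prodEFin prodr_const card_ord -exprVn.
Qed.

(** On a history atom the covered set is constant with 2|M(t)| elements, so (2|M(t)|)^m of the t^m
    equally likely selection tuples lie inside it. *)
Lemma prob_all_covered_history t h w0 : (1 <= t)%N ->
  history sel M t w0 = h ->
  (P [set w | history sel M t w = h /\ all_covered t w] =
  ((2 * #|` M t w0|%:R / t%:R) ^+ m)%:E * P [set w | history sel M t w = h])%E.
Proof.
move=> t0 hw0.
pose C := [pred j : 'I_t | `[< covered (M t w0) j.+1 >]].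
pose F (v : {ffun 'I_m -> 'I_t}) :=
  [set w | history sel M t w = h /\ forall i, sel t i w = (v i).+1].
pose S := enum (@ffun_on 'I_m C).
have -> : [set w | history sel M t w = h /\ all_covered t w] =
    \bigcup_(v in [set` S]) F v.
  apply/seteqP; split=> [w [hw D]|w [v /= vS [hw sv]]].
    have sP i : ((sel t i w).-1 < t)%N by have := @sel_range t i w t0; lia.
    exists [ffun i => Ordinal (sP i)] => /=.
      rewrite mem_enum; apply/ffun_onP => i; rewrite ffunE inE /=.
      have -> : (sel t i w).-1.+1 = sel t i w.
        by rewrite /=; have := @sel_range t i w t0; lia.
      have -> : M t w0 = M t w by apply: (@history_matching _ _ _ sel) => //; rewrite hw.
      exact: D.
    by split=> // i; rewrite ffunE /=; have := @sel_range t i w t0; lia.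
  split=> // i; rewrite sv.
  rewrite (@history_matching _ _ _ sel M t w w0)// ?hw0 ?hw//.
  by move: vS; rewrite mem_enum => /ffun_onP/(_ i); rewrite inE.
rewrite measure_fin_bigcup; last 3 first.
- by apply: finite_finset.
- move=> u v _ _ [w [[_ hu] [_ hv]]]; apply/ffunP => i; apply/val_inj.
  by apply: succn_inj; rewrite /= -hu -hv.
- move=> v _; apply: (@measurable_history t.+1) => // w w' hw [hw1 sv].
  by split=> [|i]; rewrite -?(history_sel i t0 hw)// -(history_pred t0 hw).
rewrite -fsbig_seq ?enum_uniq//.
rewrite (eq_bigr _ (fun v _ => prob_selection h v t0)).
have /fineK <- : P [set w | history sel M t w = h] \is a fin_num.
  by apply: fin_num_measure; case: uaP => + _ _ _; apply.
rewrite -EFinM sumEFin -EFinM; congr EFin.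
rewrite big_const_seq count_predT iter_addr_0 -cardE card_ffun_on card_ord.
rewrite (card_ord_count t (fun j => `[< covered (M t w0) j >])) (count_covered sel_range greedyM)//.
rewrite -[LHS]mulr_natl natrX -mul2n natrM mulrA; congr (_ * _).
by rewrite expr_div_n.
Qed.

(** The factor of [prob_all_covered_history] depends on the history only through |M(t)|, so summing
    over the atoms with |M(t)| = x preserves it. *)
Lemma prob_card_all_covered t x : (1 <= t)%N ->
  (P ([set w | #|` M t w| = x] `&` all_covered t) =
   ((2 * x%:R / t%:R) ^+ m)%:E * P [set w | #|` M t w| = x])%E.
Proof.
move=> t0; have [mh _ _ _] := uaP.
apply: (measure_scale_fibers (h := history sel M t)) => h.
- by apply: measurableI; [apply: measurableI;
    [exact: measurable_card|exact: measurable_all_covered]|exact: mh].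
- by apply: measurableI; [exact: measurable_card|exact: mh].
have [[w0 w0x hw0]|nw] :=
    pselect (exists2 w, #|` M t w| = x & history sel M t w = h); last first.
  have e0 : [set w | #|` M t w| = x] `&` [set w | history sel M t w = h] = set0.
    by apply/seteqP; split=> [w [wx hw]|//]; apply: nw; exists w.
  by rewrite setIAC e0 set0I measure0 mule0.
have eh : [set w | #|` M t w| = x] `&` [set w | history sel M t w = h] =
    [set w | history sel M t w = h].
  apply/seteqP; split=> [w []//|w /= hw]; split=> //=.
  by rewrite (@history_matching _ _ _ sel M t w w0)// hw hw0.
rewrite setIAC eh -w0x; exact: prob_all_covered_history.
Qed.

(** * The law of |M(t)| and the second moment of 2|M(t)|/t - r *)

Definition card_law t x : R := fine (P [set w | #|` M t w| = x]).

Lemma card_lawE t x : (1 <= t)%N ->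
  P [set w | #|` M t w| = x] = (card_law t x)%:E.
Proof.
by move=> t0; rewrite fineK// fin_num_measure//; exact: measurable_card.
Qed.

Lemma card_law_ge0 t x : 0 <= card_law t x.
Proof. exact: fine_ge0. Qed.

Lemma card_law_eq0 t x : (1 <= t)%N -> (t < x.*2)%N -> card_law t x = 0.
Proof.
move=> t0 tx; rewrite /card_law (_ : [set _ | _] = set0) ?measure0//.
apply/seteqP; split=> [w /= wx|//].
by have := card_matching_le sel_range greedyM w t0; rewrite wx leqNgt tx.
Qed.

Lemma card_law1 x : card_law 1 x = (x == 0%N)%:R.
Proof.
rewrite /card_law; case: eqP => [->|x0].
  rewrite (_ : [set _ | _] = setT) ?probability_setT//.
  by apply/seteqP; split=> // w _ /=; rewrite (greedyM w).1 cardfs0.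
rewrite (_ : [set _ | _] = set0) ?measure0//.
by apply/seteqP; split=> // w /=; rewrite (greedyM w).1 cardfs0 => /esym.
Qed.

(** Conditional probability that no edge is added at step t+1, given |M(t)| = x. *)
Let q t x : R := (2 * x%:R / t%:R) ^+ m.

Lemma prob_card_not_all_covered t x : (1 <= t)%N ->
  P ([set w | #|` M t w| = x] `\` all_covered t) =
  ((1 - q t x) * card_law t x)%:E.
Proof.
move=> t0.
transitivity (P [set w | #|` M t w| = x] -
    P ([set w | #|` M t w| = x] `&` all_covered t))%E.
  apply: measureD; [exact: measurable_card|exact: measurable_all_covered|].
  by have := ltry (card_law t x); rewrite -card_lawE.
by rewrite prob_card_all_covered// card_lawE// -EFinM -EFinB mulrBl mul1r.
Qed.

Lemma card_lawS0 t : (1 <= t)%N -> card_law t.+1 0 = q t 0 * card_law t 0.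
Proof.
move=> t0; apply: EFin_inj; rewrite -card_lawE// EFinM -card_lawE//.
rewrite -prob_card_all_covered//; congr (P _).
apply/seteqP; split=> w /=; last first.
  by move=> [w0 D]; rewrite (card_matching_stay greedyM t0 D).
have [D|D] := pselect (all_covered t w).
  by rewrite (card_matching_stay greedyM t0 D).
by rewrite (card_matching_grow greedyM t0 D).
Qed.

(** Forward equation of a pure birth chain: x+1 is reached from x+1 by staying or from x by
    growing. *)
Lemma card_lawSS t x : (1 <= t)%N ->
  card_law t.+1 x.+1 =
  q t x.+1 * card_law t x.+1 + (1 - q t x) * card_law t x.
Proof.
move=> t0; apply: EFin_inj; rewrite -card_lawE// EFinD EFinM -card_lawE//.
rewrite -prob_card_all_covered// -prob_card_not_all_covered//.
rewrite -measureU; last 3 first.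
- by apply: measurableI; [exact: measurable_card|exact: measurable_all_covered].
- by apply: measurableD; [exact: measurable_card|exact: measurable_all_covered].
- by apply/seteqP; split=> [w [[_ D] [_ nD]]|//]; exact: nD.
congr (P _); apply/seteqP; split=> w /=.
  have [D|D] := pselect (all_covered t w).
    by rewrite (card_matching_stay greedyM t0 D); left.
  by rewrite (card_matching_grow greedyM t0 D) => -[]; right.
case=> -[wx D]; first by rewrite (card_matching_stay greedyM t0 D).
by rewrite (card_matching_grow greedyM t0 D) wx.
Qed.

(** A finite sum in place of an integral; for t >= 1 the range x < t carries the whole law, because
    2|M(t)| <= t. *)
Definition card_expectation t (f : nat -> R) : R :=
  \sum_(x < t) card_law t x * f x.

Lemma card_expectationS t f : (1 <= t)%N ->
  card_expectation t.+1 f =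
  card_expectation t (fun x => q t x * f x + (1 - q t x) * f x.+1).
Proof.
move=> t0; rewrite /card_expectation big_ord_recl /= card_lawS0//.
under eq_bigr => i _ do rewrite /bump leq0n add1n card_lawSS// mulrDl.
rewrite big_split/= addrA.
(* The staying terms are reindexed; the extra one at x = t vanishes since 2t > t. *)
have -> : q t 0 * card_law t 0 * f 0%N +
    \sum_(i < t) q t i.+1 * card_law t i.+1 * f i.+1 =
    \sum_(i < t) q t i * card_law t i * f i.
  rewrite -(big_ord_recl t (fun i => q t i * card_law t i * f i))/=.
  by rewrite big_ord_recr/= card_law_eq0 ?mulr0 ?mul0r ?addr0//; lia.
by rewrite -big_split/=; apply: eq_bigr => i _; ring.
Qed.

Lemma card_expectation1 t : (1 <= t)%N -> card_expectation t (fun=> 1) = 1.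
Proof.
case: t => // t _; elim: t => [|t IH].
  by rewrite /card_expectation big_ord1 card_law1 mulr1.
rewrite card_expectationS// -[RHS]IH; apply: eq_bigr => x _; congr (_ * _); ring.
Qed.

Lemma card_second_moment r t : (1 <= m)%N -> pos_root m r -> (1 <= t)%N ->
  t%:R * card_expectation t (fun x => (2 * x%:R / t%:R - r) ^+ 2) <= 4.
Proof.
move=> m1 pr; have r1 := pos_root_lt1 m1 pr; have [r0 er] := pr.
case: t => // t _; elim: t => [|t IH].
  rewrite /card_expectation big_ord1 card_law1 mulr0 mul0r/=; nra.
set n := t.+1 in IH *.
have n0 : 0 < n%:R :> R by rewrite ltr0n.
have nS : n.+1%:R = n%:R + 1 :> R by rewrite -natr1.
pose a := card_expectation n (fun x => (2 * x%:R / n%:R - r) ^+ 2).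
(* With n a <= 4 from the induction hypothesis and n >= 1, the right side is at most 4(n - 1) + 4 =
   4n; then n cancels. *)
suff H : n.+1%:R * n%:R * card_expectation n.+1
    (fun x => (2 * x%:R / n.+1%:R - r) ^+ 2) <= (n%:R - 1) * n%:R * a + 4.
  have n1 : 1 <= n%:R :> R by rewrite ler1n.
  rewrite -(@ler_pM2l _ n%:R)// mulrCA mulrA; apply: (le_trans H).
  rewrite -/a in IH; nra.
(* Writing 4 as 4 E(1) allows the inequality to be proved separately for each x. *)
rewrite [X in _ <= _ + X](_ : 4 = 4 * card_expectation n (fun=> 1)); last first.
  by rewrite card_expectation1// mulr1.
rewrite card_expectationS// /a.
rewrite /card_expectation !big_distrr -big_split/=; apply: ler_sum => x _.
rewrite [leLHS]mulrCA [X in _ <= X + _]mulrCA [X in _ <= _ + X]mulrCA -mulrDr.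
(* Off the support the weight is zero; on it z <= 1 holds. *)
have [xn|nx] := leqP x.*2 n; last by rewrite card_law_eq0// !mul0r.
rewrite ler_wpM2l ?card_law_ge0//.
rewrite /q; set z := 2 * x%:R / n%:R.
have zE : 2 * x%:R = z * n%:R by rewrite /z divfK// gt_eqF.
have z0 : 0 <= z by rewrite /z divr_ge0// mulr_ge0.
have z1 : z <= 1 by rewrite /z ler_pdivrMr// mul1r -natrM mul2n ler_nat.
have zr := mulr_subX_ge0 m z0 (ltW r0).
have q0 : 0 <= z ^+ m by rewrite exprn_ge0.
have q1 : z ^+ m <= 1 by rewrite exprn_ile1.
rewrite (_ : r ^+ m = (2 - r) / 2) in zr; last by lra.
move: zr q0 q1; set p := z ^+ m => zr p0 p1.
rewrite -[x.+1%:R]natr1 [2 * (_ + 1)]mulrDr zE nS !mulr1.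
set k := n%:R in n0 *; pose u := (k + 1)^-1.
have k1 : k + 1 != 0 by rewrite gt_eqF// addr_gt0.
have u1 : (k + 1) * u = 1 by rewrite mulfV.
have u0 : 0 <= u by rewrite invr_ge0 addr_ge0// ltW.
rewrite -/u.
(* With u = 1/(n+1), staying moves the ratio z by -z u and growing moves it by (2 - z) u. *)
have -> : z * k * u = z - z * u by rewrite -[z in X in _ = X - _]mulr1 -u1; ring.
have -> : (z * k + 2) * u = z + (2 - z) * u.
  by rewrite -[z in X in _ = X + _]mulr1 -u1; ring.
(* [g] is the drift; [V] is the conditional mean square of the jump, scaled by (n+1)^2, and V <= 4
   as z and 2 - z lie in [0, 2]. *)
pose g := 2 * (1 - p) - z; pose V := p * z ^+ 2 + (1 - p) * (2 - z) ^+ 2.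
have -> : (k + 1) * k *
    (p * (z - z * u - r) ^+ 2 + (1 - p) * (z + (2 - z) * u - r) ^+ 2) =
    (k + 1) * k * (z - r) ^+ 2 + (k + 1) * u * k * (2 * (z - r) * g + u * V).
  by rewrite /g /V; ring.
rewrite u1 mul1r.
have zg : (z - r) * g <= - (z - r) ^+ 2 by rewrite /g; nra.
have V4 : V <= 4 by rewrite /V; nra.
have V0 : 0 <= V by rewrite /V addr_ge0// mulr_ge0 ?sqr_ge0// subr_ge0.
have ku : k * u <= 1 by nra.
have kuV : k * u * V <= 4 by nra.
(* The drift contributes at most -2k(z - r)^2, and k(k + 1) - 2k = k(k - 1). *)
have := ler_wpM2l (ltW n0) zg.
by nra.
Qed.

Lemma card_chebyshev r t e : (1 <= m)%N -> pos_root m r -> (1 <= t)%N -> 0 < e ->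
  (P [set w | (e < `|2 * #|` M t w|%:R / t%:R - r|)%R] <=
   (4 / (t%:R * e ^+ 2))%:E)%E.
Proof.
move=> m1 pr t0 e0; pose b (x : nat) := (e < `|2 * x%:R / t%:R - r|)%R.
have -> : [set w | (e < `|2 * #|` M t w|%:R / t%:R - r|)%R] =
    \big[setU/set0]_(x < t | b x) [set w | #|` M t w| = x].
  apply/seteqP; split=> [w bw|w]; last first.
    by rewrite -bigcup_seq_cond => -[x /= /andP[_ bx] ->].
  have Mt : (#|` M t w| < t)%N.
    have := card_matching_le sel_range greedyM w t0.
    by case: (#|` M t w|) => [|x] //; rewrite -addnn; lia.
  by rewrite -bigcup_seq_cond; exists (Ordinal Mt) => //=; rewrite mem_index_enum.
rewrite measure_bigsetU_ord; last 2 first.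
- by move=> x; exact: measurable_card.
- by move=> x y _ _ [w [/= wx wy]]; apply: val_inj; rewrite /= -wx -wy.
rewrite (eq_bigr (fun x : 'I_t => (card_law t x)%:E)); last first.
  by move=> x _; exact: card_lawE.
rewrite sumEFin lee_fin.
have te : 0 < t%:R * e ^+ 2 by rewrite mulr_gt0 ?exprn_gt0// ltr0n.
rewrite ler_pdivlMr//; apply: le_trans (card_second_moment m1 pr t0).
rewrite mulrCA ler_wpM2l ?ler0n//.
rewrite big_mkcond big_distrl/=; apply: ler_sum => x _.
case: ifPn => [bx|_]; last first.
  by rewrite mul0r mulr_ge0 ?card_law_ge0 ?sqr_ge0.
rewrite ler_wpM2l ?card_law_ge0// -[leRHS]real_normK ?num_real//.
by rewrite lerXn2r ?nnegrE ?(ltW e0)// ltW.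
Qed.

End process.

(** * Summability of k^-(1+e) *)

Section series.
Variable R : realType.
Implicit Types (a b r e : R) (n k : nat).

(** The ratio ((k+1)/(k+2))^-e is at least 1 - e ln(1 - 1/(k+2)), hence at least 1 + e/(k+2). This
    replaces the integral comparison. *)
Lemma powR_telescope_ge e k : 0 < e ->
  e * k.+2%:R `^ (- (1 + e)) <= k.+1%:R `^ (- e) - k.+2%:R `^ (- e).
Proof.
move=> e0.
have k1 : 0 < k.+1%:R :> R by rewrite ltr0n.
have k2 : 0 < k.+2%:R :> R by rewrite ltr0n.
have -> : k.+2%:R `^ (- (1 + e)) = k.+2%:R^-1 * k.+2%:R `^ (- e).
  rewrite opprD powRD; last by apply/implyP => _; rewrite gt_eqF.
  by rewrite powR_inv1// ltW.
have -> : k.+1%:R `^ (- e) = expR (e * - ln (k.+1%:R / k.+2%:R)) * k.+2%:R `^ (- e).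
  rewrite /powR !gt_eqF// -expRD; congr expR.
  by rewrite ln_div ?posrE//; ring.
rewrite mulrA -[X in _ <= _ - X]mul1r -mulrBl ler_wpM2r ?powR_ge0//.
rewrite lerBrDl (le_trans _ (expR_ge1Dx _))// lerD2l ler_wpM2l ?(ltW e0)//.
rewrite lerNr; have := @le_ln1Dx R (- k.+2%:R^-1).
rewrite (_ : 1 + - k.+2%:R^-1 = k.+1%:R / k.+2%:R); last first.
  apply: (mulIf (lt0r_neq0 k2)).
  by rewrite divfK ?gt_eqF// mulrDl mul1r mulNr mulVf ?gt_eqF// -natr1 addrK.
by apply; rewrite ltrN2 invf_lt1// ltr1n.
Qed.

Lemma powR_summable e : 0 < e ->
  (\sum_(0 <= k <oo) (k.+1%:R `^ (- (1 + e)))%:E < +oo :> \bar R)%E.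
Proof.
move=> e0; apply: (@le_lt_trans _ _ (1 + e^-1)%:E); last exact: ltry.
apply: lime_le; first by apply: is_cvg_nneseries => k _ _; rewrite lee_fin powR_ge0.
apply: nearW => n; rewrite sumEFin lee_fin.
case: n => [|n]; first by rewrite big_nil addr_ge0// invr_ge0 ltW.
(* The bound is sharpened to one that telescopes in the induction on [n]. *)
apply: (@le_trans _ _ (1 + e^-1 * (1 - n.+1%:R `^ (- e)))); last first.
  by rewrite lerD2l ler_piMr ?invr_ge0 ?ltW// gerBl powR_ge0.
elim: n => [|n IH]; first by rewrite big_nat1 !powR1 subrr mulr0 addr0.
rewrite big_nat_recr//=; apply: (le_trans (lerD IH (lexx _))).
rewrite -addrA lerD2l -lerBrDl -mulrBr ler_pdivlMl//.
by apply: (le_trans (powR_telescope_ge n e0)); lra.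
Qed.

End series.

(** * Interpolation between consecutive cubes *)

Lemma cube_bracket t : (1 <= t)%N -> exists k, (k.+1 ^ 3 <= t < k.+2 ^ 3)%N.
Proof.
elim: t => // -[_ _|t /(_ isT)[k /andP[k1 k2]] _]; first by exists 0%N.
have [tk|tk] := ltnP t.+2 (k.+2 ^ 3).
  by exists k; rewrite tk andbT; lia.
by exists k.+1; rewrite tk /=; nia.
Qed.

Section interpolation.
Context (R : realType) (X : nat -> nat) (r a b : R).
Hypothesis X_le : forall t, (1 <= t)%N -> ((X t).*2 <= t)%N.
Hypothesis X_mono : forall s t, (1 <= s)%N -> (s <= t)%N ->
  (X s <= X t <= X s + (t - s))%N.

Let Z t : R := 2 * (X t)%:R / t%:R.

(** The numerator X_t s - X_s t equals s(X_t - X_s) - X_s(t - s), a difference of two terms in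
    [0, s(t - s)]. *)
Lemma ratio_variation s t : (1 <= s)%N -> (s <= t)%N ->
  `|Z t - Z s| <= 2 * (t%:R - s%:R) / s%:R.
Proof.
move=> s1 st.
have s0 : 0 < s%:R :> R by rewrite ltr0n.
have t0 : 0 < t%:R :> R by rewrite ltr0n (leq_trans s1).
have st' : s%:R <= t%:R :> R by rewrite ler_nat.
have /andP[] := X_mono s1 st.
rewrite -(ler_nat R) -(ler_nat R (X t)) natrD natrB// => X1 X2.
have := X_le s1; rewrite -mul2n -(ler_nat R) natrM => X3.
have -> : Z t - Z s = (2 * (X t)%:R * s%:R - 2 * (X s)%:R * t%:R) / (t%:R * s%:R).
  by rewrite /Z; field; rewrite !gt_eqF.
rewrite normrM [X in _ * X]gtr0_norm ?invr_gt0 ?mulr_gt0//.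
rewrite ler_pdivrMr ?mulr_gt0//.
have -> : 2 * (t%:R - s%:R) / s%:R * (t%:R * s%:R) = 2 * (t%:R - s%:R) * t%:R :> R.
  by field; rewrite gt_eqF.
have Xs0 : 0 <= (X s)%:R :> R by [].
move: (X s)%:R (X t)%:R (s%:R) (t%:R) s0 t0 st' X1 X2 X3 Xs0 => x y u v *.
rewrite ler_norml; apply/andP; split; nra.
Qed.

Lemma interpolated_bound k t : 0 <= a -> a < b -> b < 3^-1 ->
  (k.+1 ^ 3 <= t < k.+2 ^ 3)%N ->
  `|Z (k.+1 ^ 3) - r| <= k.+1%:R `^ (- (3 * b)) ->
  t%:R `^ a * `|Z t - r| <= 30 * k.+1%:R `^ (- (3 * (b - a))).
Proof.
move=> a0 ab b3 /andP[kt tk] Zk.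
have K0 : 0 < k.+1%:R :> R by rewrite ltr0n.
have K1 : 1 <= k.+1%:R :> R by rewrite ler1n.
have s0 : (1 <= k.+1 ^ 3)%N by rewrite expn_gt0.
have t8 : t%:R <= (2 * k.+1%:R) ^+ 3 :> R.
  by rewrite -natrM -natrX ler_nat; apply: (leq_trans (ltnW tk)); rewrite leq_exp2r//; lia.
(* Here 2^(3a) <= 2, as 3a < 1. *)
have ta : t%:R `^ a <= 2 * k.+1%:R `^ (3 * a).
  apply: (@le_trans _ _ (((2 * k.+1%:R) ^+ 3) `^ a)).
    by rewrite ge0_ler_powR ?nnegrE ?exprn_ge0 ?mulr_ge0.
  rewrite -powR_mulrn ?mulr_ge0// -powRrM powRM//.
  by rewrite ler_wpM2r ?powR_ge0// -[leRHS]powRr1// ler_powR//; lra.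
have Zt : `|Z t - r| <= 15 * k.+1%:R `^ (- (3 * b)).
  have -> : Z t - r = (Z (k.+1 ^ 3)%N - r) + (Z t - Z (k.+1 ^ 3)%N) by lra.
  apply: (le_trans (ler_normD _ _)).
  (* The variation O(1/k) is absorbed by the target rate because 3b < 1. *)
  have : k.+1%:R^-1 <= k.+1%:R `^ (- (3 * b)).
    by rewrite -powR_inv1// ler_powR//; lra.
  (* With K = k+1 >= 1, (K + 1)^3 - K^3 <= 7 K^2, doubled to 14; adding the error at the cube gives
     15. *)
  suff : 2 * (t%:R - (k.+1 ^ 3)%:R) / (k.+1 ^ 3)%:R <= 14 * k.+1%:R^-1 :> R.
    move=> h1 h2; apply: (le_trans (lerD Zk (le_trans (ratio_variation s0 kt) h1))).
    by move: h2; move: (_ `^ _) (_^-1) => x y; lra.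
  rewrite natrX ler_pdivrMr ?exprn_gt0//.
  have : t%:R <= k.+2%:R ^+ 3 :> R by rewrite -natrX ler_nat ltnW.
  rewrite -[k.+2%:R]natr1.
  have -> : 14 * k.+1%:R^-1 * k.+1%:R ^+ 3 = 14 * k.+1%:R ^+ 2 :> R.
    by field; rewrite gt_eqF.
  by move: k.+1%:R K0 K1 => u *; nra.
apply: (le_trans (ler_pM _ _ ta Zt)); rewrite ?powR_ge0//.
rewrite (_ : - (3 * (b - a)) = 3 * a + - (3 * b)); last by ring.
rewrite powRD; last by apply/implyP => _; rewrite gt_eqF.
by move: (_ `^ _) (_ `^ _) => u v; lra.
Qed.

Lemma interpolation_cvg c : 0 <= a -> c <= a -> a < b -> b < 3^-1 ->
  (\forall k \near \oo, `|Z (k.+1 ^ 3) - r| <= k.+1%:R `^ (- (3 * b))) ->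
  (fun t => t%:R `^ c * `|Z t - r|) @ \oo --> (0 : R).
Proof.
move=> a0 ca ab b3 [K _ HK]; apply/cvgrPdist_le => e e0.
pose dl := 3 * (b - a); have dl0 : 0 < dl by rewrite /dl; lra.
(* Threshold beyond which 30 K^-dl <= e; below, 8 B^3 <= t < (2K)^3 forces B <= K. *)
pose B := (30 / e) `^ dl^-1.
have B0 : 0 <= B by exact: powR_ge0.
near=> t.
have t1 : (1 <= t)%N by near: t; exact: nbhs_infty_ge.
have [k ktP] := cube_bracket t1; have /andP[kt tk] := ktP.
have Kk : (K <= k)%N.
  have Kt : (K.+1 ^ 3 <= t)%N by near: t; exact: nbhs_infty_ge.
  by have := leq_ltn_trans Kt tk; rewrite ltn_exp2r.
have Bk : B <= k.+1%:R.
  have Bt : 8 * B ^+ 3 <= t%:R.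
    by near: t; exact: nbhs_infty_ger.
  have : (2 * B) ^+ 3 <= (2 * k.+1%:R) ^+ 3.
    apply: (@le_trans _ _ t%:R); first by rewrite exprMn; lra.
    by rewrite -natrM -natrX ler_nat (leq_trans (ltnW tk))// leq_exp2r//; lia.
  rewrite ler_pXn2r ?nnegrE ?mulr_ge0//; lra.
rewrite sub0r normrN ger0_norm ?mulr_ge0 ?powR_ge0//.
apply: (@le_trans _ _ (t%:R `^ a * `|Z t - r|)).
  by rewrite ler_wpM2r// ler_powR// ler1n.
apply: (le_trans (interpolated_bound a0 ab b3 ktP (HK _ Kk))).
rewrite -/dl powRN.
have : 30 / e <= k.+1%:R `^ dl.
  have -> : 30 / e = B `^ dl.
    by rewrite /B -powRrM mulVf ?gt_eqF// powRr1// divr_ge0// ltW.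
  by rewrite ge0_ler_powR ?nnegrE// ltW.
have kd : 0 < k.+1%:R `^ dl by rewrite powR_gt0.
by rewrite ler_pdivrMr// ler_pdivrMr// mulrC.
Unshelve. all: by end_near. Qed.

End interpolation.

(** * Almost sure convergence by Borel-Cantelli, and the theorem *)

Lemma matching_rate_ae (R : realType) (m : nat) (r : R) (d : measure_display)
    (T : measurableType d) (P : probability T R) (sel : nat -> 'I_m -> T -> nat)
    (M : nat -> T -> {fset {fset nat}}) (alpha : R) :
  (1 <= m)%N -> pos_root m r ->
  uniform_attachment P sel M -> greedy_matching sel M -> alpha < 3^-1 ->
  {ae P, forall w,
    (fun t : nat => t%:R `^ alpha * `| 2 * #|` M t w|%:R / t%:R - r |)
      @ \oo --> (0 : R)}.
Proof.
move=> m1 pr uaP gM a3.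
have sel_range : forall t i w, (1 <= t)%N -> (1 <= sel t i w <= t)%N by case: uaP.
(* A negative [alpha] is replaced by 0; [b] is the midpoint of [a] and 1/3. *)
pose a := Num.max alpha 0; pose b := (a + 3^-1) / 2.
have a0 : 0 <= a by rewrite le_max lexx orbT.
have aa : alpha <= a by rewrite le_max lexx.
have a3' : a < 3^-1 by rewrite gt_max a3 invr_gt0 ltr0n.
have ab : a < b by rewrite /b; lra.
have b3 : b < 3^-1 by rewrite /b; lra.
pose F k := [set w | (k.+1%:R `^ (- (3 * b)) <
  `|2 * #|` M (k.+1 ^ 3)%N w|%:R / (k.+1 ^ 3)%:R - r|)%R].
have k3 k : (1 <= k.+1 ^ 3)%N by rewrite expn_gt0.
have mF k : measurable (F k).
  apply: (measurable_history uaP (k3 k)) => w w'.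
  by rewrite /F /= => /(history_matching (k3 k)) ->.
have PF : P (lim_sup_set F) = 0.
  apply: lim_sup_set_cvg0 => //.
  (* At t = K^3 with deviation K^(-3b), Chebyshev gives 4 K^(6b - 3) = 4 K^-(1 + e), and b < 1/3
     makes e positive. *)
  pose e := 2 - 6 * b; have e0 : 0 < e by rewrite /e; lra.
  apply: (@le_lt_trans _ _
      (4%:E * \sum_(0 <= k <oo) (k.+1%:R `^ (- (1 + e)))%:E)%E); last first.
    have := powR_summable e0; set S := (X in (X < _)%E) => S1.
    have S0 : (0 <= S)%E by apply: nneseries_ge0 => k _ _; rewrite lee_fin powR_ge0.
    by rewrite lte_mul_pinfty// ge0_fin_numE.
  rewrite -nneseriesZl; last by move=> k _; rewrite lee_fin powR_ge0.
  apply: lee_nneseries => // k _.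
  have kb : 0 < k.+1%:R `^ (- (3 * b)) by rewrite powR_gt0.
  apply: (le_trans (card_chebyshev uaP gM m1 pr (k3 k) kb)).
  rewrite -EFinM lee_fin ler_wpM2l// natrX -!powR_mulrn ?powR_ge0//.
  rewrite -powRrM -powRD; last by apply/implyP => _; rewrite gt_eqF.
  rewrite -powRN ler_powR ?ler1n// /e; lra.
(* Outside the limsup set only finitely many [F k] occur, which is the eventual bound required by
   [interpolation_cvg]. *)
suff : P.-negligible (lim_sup_set F).
  apply: negligibleS => w /= nQ; apply: contrapT => nF; apply: nQ.
  apply: (interpolation_cvg (b := b) (X := fun t => #|` M t w|) _ _ a0 aa ab b3).
  - by move=> t; exact: (card_matching_le sel_range gM).
  - by move=> s t; exact: (card_matching_mono gM).
  move/existsNP: nF => [K /not_implyP[_ nF]].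
  exists K => // k /= Kk; rewrite leNgt; apply/negP => Fk.
  by apply: nF; exists k.
by apply/negligibleP => //; apply: bigcap_measurable => // n _;
  apply: bigcup_measurable.
Qed.

Theorem theorem2p8 (R : realType) :
  exists r : nat -> R,
    [/\ forall m : nat, (1 <= m)%N ->
          pos_root m (r m) /\ forall z : R, pos_root m z -> z = r m,
        (fun m : nat => r m - (1 - m%:R^-1 * ln 2)) =O_\oo
          (fun m : nat => (m%:R ^- 2 : R)) &
        forall (m : nat), (1 <= m)%N ->
        forall (d : measure_display) (T : measurableType d)
          (P : probability T R) (sel : nat -> 'I_m -> T -> nat)
          (M : nat -> T -> {fset {fset nat}}),
        uniform_attachment P sel M -> greedy_matching sel M ->
        forall alpha : R, alpha < 3^-1 ->
        {ae P, forall w,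
          (fun t : nat =>
             t%:R `^ alpha * `| 2 * #|` M t w|%:R / t%:R - r m |)
            @ \oo --> (0 : R)}].
Proof.
have /choice[r rP] m : exists x : R, (1 <= m)%N -> pos_root m x.
  (* The value 0 at m = 0 is a placeholder. *)
  case: m => [|m]; first by exists 0.
  by have [x xP] := @pos_root_exists R m.+1 isT; exists x.
exists r; split.
- move=> m m1; split; first exact: rP.
  by move=> z zP; exact: pos_root_uniq zP (rP m m1).
- apply/eqOP; exists 2; split; first exact: num_real.
  move=> k k2; near=> m.
  have m1 : (1 <= m)%N by near: m; exact: nbhs_infty_ge.
  apply: (le_trans (pos_root_asymptotics m1 (rP m m1))).
  by rewrite ger0_norm ?ler_wpM2r ?(ltW k2)// invr_ge0 exprn_ge0.
- move=> m m1 d T P sel M uaP gM alpha.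
  exact: matching_rate_ae m1 (rP m m1) uaP gM.
Unshelve. all: by end_near. Qed.
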